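(* Let $\mathbb{V}_\downarrow$ be the lower Vietoris monad on $\mathbf{Top}$, i.e. the monad induced by the dual adjunction $\mathbf{Top}(-,\mathbb{S})\dashv\mathbf{CJSL}(-,2)\colon\mathbf{CJSL}^{\mathrm{op}}\to\mathbf{Top}$, whose underlying object $\mathbf{CJSL}(\mathbf{Top}(X,\mathbb{S}),2)$ is homeomorphic to the space $\mathbb{V}_\downarrow X$ of closed subsets of $X$ with the topology generated by the sets $\Diamond U=\{C \text{ closed}\mid C\cap U\neq\emptyset\}$ for $U\subseteq X$ open. Then $\mathbb{V}_\downarrow$ is the codensity monad of the functor $U_{\mathcal{P}}\colon\mathbf{Kl}(\mathcal{P})\to\mathbf{Top}$ sending a set $X$ to $\mathbb{S}^X$.
   Context: $\mathbb{S}$ is the Sierpinski space on $\{0,1\}$ with open sets $\emptyset,\{1\},\{0,1\}$. $\mathbf{CJSL}$ is the category of complete join-semilattices and join-preserving maps, $2=\{0,1\}$ the two-element complete join-semilattice; $\mathbf{Top}(X,\mathbb{S})$ (the open sets of $X$) carries the pointwise complete join-semilattice structure, and $\mathbf{CJSL}(J,2)$ (complete ideals of $J$) is topologized as a subspace of $\mathbb{S}^{|J|}$. $\mathbf{Kl}(\mathcal{P})$ is the Kleisli category of the power set monad $\mathcal{P}$ on $\mathbf{Set}$ (objects sets, morphisms $f\colon X\to\mathcal{P}Y$); $U_{\mathcal{P}}$ sends $X$ to the power $\mathbb{S}^X$ (identified with $\mathcal{P}X$ via characteristic maps) and $f$ to $f^\#\colon A\mapsto\bigcup_{x\in A}f(x)$.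 The codensity monad of a functor $F$ is $\mathrm{Ran}_FF$ with its canonical monad structure; ''is the codensity monad'' means isomorphic as monads. *)

(* Defs.v *)
From HB Require Import structures.
From mathcomp Require Import all_boot all_order all_classical.
From mathcomp Require Import topology.

Set Implicit Arguments.
Unset Strict Implicit.
Unset Printing Implicit Defensive.

Local Open Scope classical_set_scope.

Record category := Category {
  obj :> Type;
  hom : obj -> obj -> Type;
  idm : forall X, hom X X;
  cpm : forall X Y Z, hom Y Z -> hom X Y -> hom X Z;
  cpmA : forall X Y Z W (h : hom Z W) (g : hom Y Z) (f : hom X Y),
    cpm h (cpm g f) = cpm (cpm h g) f;
  cpm1 : forall X Y (f : hom X Y), cpm f (idm X) = f;
  cp1m : forall X Y (f : hom X Y), cpm (idm Y) f = f }.
Arguments idm {c}.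

Notation "g ∘ f" := (cpm g f) (at level 40, left associativity).

Definition opposite (C : category) : category :=
  @Category C (fun X Y => hom Y X) idm (fun _ _ _ g f => f ∘ g)
    (fun _ _ _ _ h g f => esym (cpmA f g h))
    (fun _ _ f => cp1m f) (fun _ _ f => cpm1 f).

Record functor (C D : category) := Functor {
  fobj :> C -> D;
  fmap : forall X Y : C, hom X Y -> hom (fobj X) (fobj Y);
  fmap1 : forall X : C, fmap (idm X) = idm (fobj X);
  fmapM : forall (X Y Z : C) (g : hom Y Z) (f : hom X Y),
    fmap (g ∘ f) = fmap g ∘ fmap f }.

Definition functor_id (C : category) : functor C C :=
  @Functor C C id (fun _ _ f => f) (fun _ => erefl) (fun _ _ _ _ _ => erefl).

Section FunctorComp.
Variables (A B C : category) (G : functor B C) (F : functor A B).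
Let map (X Y : A) (f : hom X Y) : hom (G (F X)) (G (F Y)) := fmap G (fmap F f).

Fact functor_comp1 X : map (idm X) = idm (G (F X)).
Proof. by rewrite /map !fmap1. Qed.

Fact functor_compM (X Y Z : A) (g : hom Y Z) (f : hom X Y) :
  map (g ∘ f) = map g ∘ map f.
Proof. by rewrite /map !fmapM. Qed.

Definition functor_comp : functor A C := Functor functor_comp1 functor_compM.
End FunctorComp.
Notation "G ∘F F" := (functor_comp G F) (at level 40, left associativity).

Record nat_trans (C D : category) (F G : functor C D) := NatTrans {
  ntr :> forall X : C, hom (F X) (G X);
  ntr_nat : forall (X Y : C) (f : hom X Y), ntr Y ∘ fmap F f = fmap G f ∘ ntr X }.
Notation "F ⟹ G" := (nat_trans F G) (at level 60).

Definition isomorphic (C : category) (X Y : C) :=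
  exists (f : hom X Y) (g : hom Y X), g ∘ f = idm X /\ f ∘ g = idm Y.

Record monad (C : category) := Monad {
  mfun :> functor C C;
  munit : functor_id C ⟹ mfun;
  mmult : mfun ∘F mfun ⟹ mfun;
  mmult_unitl : forall X, mmult X ∘ munit (mfun X) = idm (mfun X);
  mmult_unitr : forall X, mmult X ∘ fmap mfun (munit X) = idm (mfun X);
  mmultA : forall X, mmult X ∘ mmult (mfun X) = mmult X ∘ fmap mfun (mmult X) }.
Arguments munit {C}.
Arguments mmult {C}.

Definition is_monad_morphism (C : category) (S T : monad C) (phi : S ⟹ T) :=
  (forall X : C, phi X ∘ munit S X = munit T X) /\
  (forall X : C, phi X ∘ mmult S X = mmult T X ∘ (fmap T (phi X) ∘ phi (S X))).

Definition monad_isomorphic (C : category) (S T : monad C) :=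
  exists (phi : S ⟹ T) (psi : T ⟹ S),
    [/\ is_monad_morphism phi, is_monad_morphism psi,
        forall X, psi X ∘ phi X = idm (S X) & forall X, phi X ∘ psi X = idm (T X)].

Record adjunction (C D : category) (L : functor C D) (R : functor D C) :=
  Adjunction {
    aunit : functor_id C ⟹ R ∘F L;
    acounit : L ∘F R ⟹ functor_id D;
    atriangleL : forall X, acounit (L X) ∘ fmap L (aunit X) = idm (L X);
    atriangleR : forall Y, fmap R (acounit Y) ∘ aunit (R Y) = idm (R Y) }.

Section AdjunctionMonad.
Variables (C D : category) (L : functor C D) (R : functor D C).
Variable adj : adjunction L R.
Let T := R ∘F L.
Let mu (X : C) : hom (T (T X)) (T X) := fmap R (acounit adj (L X)).

Fact adjunction_mult_nat (X Y : C) (f : hom X Y) :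
  mu Y ∘ fmap (T ∘F T) f = fmap T f ∘ mu X.
Proof.
by rewrite /mu /= -!fmapM; congr fmap; exact: (ntr_nat (acounit adj) (fmap L f)).
Qed.

Definition adjunction_mult : T ∘F T ⟹ T := NatTrans adjunction_mult_nat.

Fact adjunction_mult_unitl X : adjunction_mult X ∘ aunit adj (T X) = idm (T X).
Proof. exact: (atriangleR adj (L X)). Qed.

Fact adjunction_mult_unitr X :
  adjunction_mult X ∘ fmap T (aunit adj X) = idm (T X).
Proof. by rewrite /= /mu -fmapM atriangleL fmap1. Qed.

Fact adjunction_multA X : adjunction_mult X ∘ adjunction_mult (T X) =
  adjunction_mult X ∘ fmap T (adjunction_mult X).
Proof.
rewrite /= /mu -!fmapM; congr fmap.
exact: (esym (ntr_nat (acounit adj) (acounit adj (L X)))).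
Qed.

Definition adjunction_monad : monad C :=
  Monad adjunction_mult_unitl adjunction_mult_unitr adjunction_multA.
End AdjunctionMonad.

Definition is_right_kan (A B C : category) (K : functor A B) (F : functor A C)
    (R : functor B C) (eps : R ∘F K ⟹ F) :=
  forall (G : functor B C) (alpha : G ∘F K ⟹ F),
    exists! beta : G ⟹ R, forall a, eps a ∘ beta (K a) = alpha a.

(* The last two clauses say that the unit and the multiplication are the       *)
(* transformations which the universal property of [(T, eps)] assigns to       *)
(* [id : F ⟹ F] and to [eps ∘ T eps : T T F ⟹ F].                              *)
Definition is_codensity_monad (A C : category) (F : functor A C) (T : monad C) :=
  exists eps : T ∘F F ⟹ F,
    [/\ is_right_kan eps,
        forall a, eps a ∘ munit T (F a) = idm (F a) &
        forall a, eps a ∘ mmult T (F a) = eps a ∘ fmap T (eps a)].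

Section TopCat.
Implicit Types X Y Z W : topologicalType.

Definition top_comp X Y Z (g : continuousType Y Z) (f : continuousType X Y) :
  continuousType X Z := g \o f.

Fact top_compA X Y Z W (h : continuousType Z W) (g : continuousType Y Z)
  (f : continuousType X Y) : top_comp h (top_comp g f) = top_comp (top_comp h g) f.
Proof. exact/continuousEP. Qed.

Fact top_comp1 X Y (f : continuousType X Y) : top_comp f idfun = f.
Proof. exact/continuousEP. Qed.

Fact top_1comp X Y (f : continuousType X Y) : top_comp idfun f = f.
Proof. exact/continuousEP. Qed.
End TopCat.

Definition Top : category :=
  @Category topologicalType (fun X Y => continuousType X Y)
    (fun X => idfun) top_comp top_compA top_comp1 top_1comp.

Record cjsl := Cjsl {
  cjsl_disp : Order.disp_t;
  cjsl_sort :> porderType cjsl_disp;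
  cjsl_join : set cjsl_sort -> cjsl_sort;
  cjsl_joinP : forall A, supremums A (cjsl_join A) }.
Arguments cjsl_join {c}.

Record cjsl_hom (J K : cjsl) := CjslHom {
  cjsl_fun :> J -> K;
  cjsl_funP : forall A : set J, cjsl_fun (cjsl_join A) = cjsl_join (cjsl_fun @` A) }.

Lemma cjsl_homP (J K : cjsl) (f g : cjsl_hom J K) : f =1 g -> f = g.
Proof.
case: f g => [f fP] [g gP] /= /funext fg; subst g.
by rewrite (Prop_irrelevance fP gP).
Qed.

Section CjslCat.
Implicit Types J K M N : cjsl.

Fact cjsl_id_join J (A : set J) : idfun (cjsl_join A) = cjsl_join (idfun @` A).
Proof. by rewrite image_id. Qed.

Definition cjsl_id J : cjsl_hom J J := CjslHom (@cjsl_id_join J).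

Fact cjsl_comp_join J K M (g : cjsl_hom K M) (f : cjsl_hom J K) (A : set J) :
  (g \o f) (cjsl_join A) = cjsl_join ((g \o f) @` A).
Proof. by rewrite /= !cjsl_funP image_comp. Qed.

Definition cjsl_comp J K M (g : cjsl_hom K M) (f : cjsl_hom J K) : cjsl_hom J M :=
  CjslHom (cjsl_comp_join g f).

Fact cjsl_compA J K M N (h : cjsl_hom M N) (g : cjsl_hom K M) (f : cjsl_hom J K) :
  cjsl_comp h (cjsl_comp g f) = cjsl_comp (cjsl_comp h g) f.
Proof. exact: cjsl_homP. Qed.

Fact cjsl_comp1 J K (f : cjsl_hom J K) : cjsl_comp f (cjsl_id J) = f.
Proof. exact: cjsl_homP. Qed.

Fact cjsl_1comp J K (f : cjsl_hom J K) : cjsl_comp (cjsl_id K) f = f.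
Proof. exact: cjsl_homP. Qed.
End CjslCat.

Definition CJSL : category :=
  @Category cjsl cjsl_hom cjsl_id cjsl_comp cjsl_compA cjsl_comp1 cjsl_1comp.

Definition bool_join (A : set bool) : bool := `[< A true >].

Fact bool_joinP (A : set bool) : supremums A (bool_join A).
Proof.
split=> [[] Ab|b Ab]; first by rewrite /bool_join asboolT.
- by case: bool_join.
- rewrite /bool_join; case: asboolP => [/Ab//|_]; by case: b {Ab}.
Qed.

Definition two : cjsl := Cjsl bool_joinP.

(* The library's topology on [bool] is discrete, hence the alias.              *)
Definition sierpinski : Type := bool.
HB.instance Definition _ := Choice.copy sierpinski bool.

Definition sierpinski_open : set_system sierpinski :=
  [set A | [\/ A = set0, A = [set true] | A = setT]].

Lemma sierpinski_openP (A : set sierpinski) :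
  sierpinski_open A <-> (A false -> A true).
Proof.
split=> [[->|->|->]//|A01].
have [A0|A0] := pselect (A false); have [A1|A1] := pselect (A true).
- by apply: Or33; apply/seteqP; split=> // -[].
- by have := A1 (A01 A0).
- by apply: Or32; apply/seteqP; split=> [[]//|_ ->].
- by apply: Or31; apply/seteqP; split=> [[]//|].
Qed.

Fact sierpinski_openT : sierpinski_open setT.
Proof. exact: Or33. Qed.

Fact sierpinski_openI : setI_closed sierpinski_open.
Proof.
move=> A B /sierpinski_openP A01 /sierpinski_openP B01.
by apply/sierpinski_openP => -[/A01 ? /B01].
Qed.

Fact sierpinski_open_bigU (I : Type) (f : I -> set sierpinski) :
  (forall i, sierpinski_open (f i)) -> sierpinski_open (\bigcup_i f i).
Proof.
move=> fP; apply/sierpinski_openP => -[i _ fi].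
by exists i => //; exact: (sierpinski_openP _).1 (fP i) fi.
Qed.

HB.instance Definition _ := isOpenTopological.Build sierpinski
  sierpinski_openT sierpinski_openI sierpinski_open_bigU.

Lemma continuous_sierpinski (X : topologicalType) (f : X -> sierpinski) :
  continuous f <-> open [set x | f x = true].
Proof.
split=> [/continuousP cf|oU].
  by apply: (cf [set true]); exact: Or32.
apply/continuousP => A [->|->|->]; rewrite ?preimage_set0 ?preimage_setT //.
- exact: open0.
- exact: openT.
Qed.

Lemma continuous_initial (X : topologicalType) (S : choiceType)
    (Y : topologicalType) (i : S -> Y) (f : X -> initial_topology i) :
  continuous (i \o f) -> continuous f.
Proof.
by move=> /continuousP cif; apply/continuousP => _ [B oB <-]; exact: (cif B oB).
Qed.

Lemma continuous_power (X : topologicalType) (I : Type) (Y : topologicalType)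
    (f : X -> {ptws I -> Y}) :
  (forall i, continuous (fun x => f x i)) -> continuous f.
Proof.
move=> cf x; apply/cvg_sup => i.
exact: (@continuous_initial _ {ptws I -> Y} _ (fun g => g i) f (cf i)).
Qed.

Lemma continuous_eval (I : Type) (Y : topologicalType) (i : I) :
  continuous (fun g : {ptws I -> Y} => g i).
Proof. by apply: (@proj_continuous {classic I} (fun _ => Y) i). Qed.

(* An open set is represented by its characteristic map.                       *)
Definition opens (X : topologicalType) : Type := continuousType X sierpinski.
HB.instance Definition _ (X : topologicalType) :=
  Choice.copy (opens X) (continuousType X sierpinski).

Section Opens.
Variable X : topologicalType.
Implicit Types f g h : opens X.

Definition opens_le f g := `[< forall x : X, ((f x : bool) <= (g x : bool))%O >].
Definition opens_lt f g := (g != f) && opens_le f g.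

Fact opens_lt_def f g : opens_lt f g = (g != f) && opens_le f g.
Proof. by []. Qed.

Fact opens_le_refl : reflexive opens_le.
Proof. by move=> f; apply/asboolP => x; exact: Order.POrderTheory.lexx. Qed.

Fact opens_le_anti : antisymmetric opens_le.
Proof.
move=> f g /andP[/asboolP fg /asboolP gf]; apply/continuousEP => x.
by apply: Order.POrderTheory.le_anti; rewrite fg gf.
Qed.

Fact opens_le_trans : transitive opens_le.
Proof.
move=> g f h /asboolP fg /asboolP gh; apply/asboolP => x.
exact: Order.POrderTheory.le_trans (fg x) (gh x).
Qed.

HB.instance Definition _ := Order.isPOrder.Build FunOrder.fun_display (opens X)
  opens_lt_def opens_le_refl opens_le_anti opens_le_trans.
Definition opens_join_fun (A : set (opens X)) (x : X) : sierpinski :=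
  cjsl_join [set (f x : two) | f in A].

Fact opens_join_continuous A : continuous (opens_join_fun A).
Proof.
apply/continuous_sierpinski.
rewrite (_ : [set _ | _] = \bigcup_(f in A) [set x | f x = true]).
  by apply: bigcup_open => f _; apply/continuous_sierpinski; exact: cts_fun.
apply/seteqP; split=> x /=.
- by move=> /asboolP[f Af fx]; exists f.
- by move=> [f Af fx]; apply/asboolP; exists f.
Qed.

Definition opens_join (A : set (opens X)) : opens X :=
  mkcts (@opens_join_continuous A).

Fact opens_joinP (A : set (opens X)) : supremums A (opens_join A).
Proof.
split=> [f Af|g Ag]; apply/asboolP => x.
- by apply: (bool_joinP [set f x | f in A]).1; exists f.
- apply: (bool_joinP [set f x | f in A]).2 => _ [f Af <-].
  by have /asboolP := Ag _ Af; apply.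
Qed.

Definition opens_cjsl : cjsl := Cjsl opens_joinP.
End Opens.

Section OpensMap.
Variables (X Y : topologicalType) (f : continuousType X Y).

Definition opens_map_fun (U : opens Y) : opens X := top_comp U f.

Fact opens_map_join (A : set (opens Y)) :
  opens_map_fun (opens_join A) = opens_join (opens_map_fun @` A).
Proof.
by apply/continuousEP => x; congr bool_join; rewrite image_comp.
Qed.

Definition opens_map : cjsl_hom (opens_cjsl Y) (opens_cjsl X) :=
  @CjslHom (opens_cjsl Y) (opens_cjsl X) opens_map_fun opens_map_join.
End OpensMap.

Fact opens_map1 (X : Top) :
  opens_map (idm X) = idm (c := opposite CJSL) (opens_cjsl X).
Proof. by apply: cjsl_homP => U; exact/continuousEP. Qed.

Fact opens_mapM (X Y Z : Top) (g : hom Y Z) (f : hom X Y) :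
  opens_map (g ∘ f) = cpm (c := opposite CJSL) (opens_map g) (opens_map f).
Proof. by apply: cjsl_homP => U; exact/continuousEP. Qed.

Definition Top_sierpinski : functor Top (opposite CJSL) :=
  @Functor Top (opposite CJSL) opens_cjsl opens_map opens_map1 opens_mapM.

Definition cjsl_points (J : cjsl) : Type := cjsl_hom J two.
HB.instance Definition _ (J : cjsl) := gen_eqMixin (cjsl_points J).
HB.instance Definition _ (J : cjsl) := gen_choiceMixin (cjsl_points J).

Definition cjsl_points_val (J : cjsl) (phi : cjsl_points J) : {ptws J -> sierpinski} :=
  fun j => phi j.

HB.instance Definition _ (J : cjsl) :=
  Topological.copy (cjsl_points J) (initial_topology (@cjsl_points_val J)).

Lemma continuous_cjsl_points (X : topologicalType) (J : cjsl)
    (f : X -> cjsl_points J) :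
  (forall j, continuous (fun x => f x j : sierpinski)) -> continuous f.
Proof.
by move=> cf; apply: continuous_initial; exact: continuous_power.
Qed.

Lemma continuous_cjsl_eval (J : cjsl) (j : J) :
  continuous (fun phi : cjsl_points J => phi j : sierpinski).
Proof.
move=> phi; apply: (@continuous_comp _ _ _ (@cjsl_points_val J)
  (fun g : {ptws J -> sierpinski} => g j)).
- exact: initial_continuous.
- exact: continuous_eval.
Qed.

Section CjslPointsMap.
Variables (J K : cjsl) (h : cjsl_hom K J).

Definition cjsl_points_map_fun (phi : cjsl_points J) : cjsl_points K :=
  cjsl_comp phi h.

Fact cjsl_points_map_continuous : continuous cjsl_points_map_fun.
Proof.
by apply: continuous_cjsl_points => k; exact: continuous_cjsl_eval.
Qed.

Definition cjsl_points_map : continuousType (cjsl_points J) (cjsl_points K) :=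
  mkcts cjsl_points_map_continuous.
End CjslPointsMap.

Fact cjsl_points_map1 (J : opposite CJSL) :
  cjsl_points_map (idm J) = idm (c := Top) (cjsl_points J).
Proof. by apply/continuousEP => phi; exact: cjsl_homP. Qed.

Fact cjsl_points_mapM (J K M : opposite CJSL) (g : hom K M) (f : hom J K) :
  cjsl_points_map (g ∘ f) =
  cpm (c := Top) (cjsl_points_map g) (cjsl_points_map f).
Proof. by apply/continuousEP => phi; exact: cjsl_homP. Qed.

Definition CJSL_two : functor (opposite CJSL) Top :=
  @Functor (opposite CJSL) Top (fun J => cjsl_points J)
    (fun J K h => @cjsl_points_map J K h) cjsl_points_map1 cjsl_points_mapM.

Section DualUnit.
Variable X : topologicalType.

Fact dual_unit_join (x : X) (A : set (opens_cjsl X)) :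
  ((cjsl_join A : opens X) x : two) =
  cjsl_join [set ((f : opens X) x : two) | f in A].
Proof. by []. Qed.

Definition dual_unit_fun (x : X) : cjsl_points (opens_cjsl X) :=
  @CjslHom (opens_cjsl X) two (fun f => (f : opens X) x) (dual_unit_join x).

Fact dual_unit_continuous : continuous dual_unit_fun.
Proof.
by apply: continuous_cjsl_points => f; exact: (@cts_fun _ _ (f : opens X)).
Qed.

Definition dual_unit : continuousType X (cjsl_points (opens_cjsl X)) :=
  mkcts dual_unit_continuous.
End DualUnit.

Section DualCounit.
Variable J : cjsl.

Definition dual_counit_fun (j : J) : opens (cjsl_points J) :=
  mkcts (@continuous_cjsl_eval J j).

Fact dual_counit_join (A : set J) :
  dual_counit_fun (cjsl_join A) = opens_join (dual_counit_fun @` A).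
Proof.
apply/continuousEP => phi; rewrite /= /mkcts cjsl_funP /opens_join_fun.
by rewrite image_comp.
Qed.

Definition dual_counit : cjsl_hom J (opens_cjsl (cjsl_points J)) :=
  @CjslHom J (opens_cjsl (cjsl_points J)) dual_counit_fun dual_counit_join.
End DualCounit.

Fact dual_unit_nat (X Y : Top) (f : hom X Y) :
  cpm (c := Top) (dual_unit Y) f =
  cpm (c := Top) (fmap (CJSL_two ∘F Top_sierpinski) f) (dual_unit X).
Proof. by apply/continuousEP => x; exact: cjsl_homP. Qed.

Fact dual_counit_nat (J K : opposite CJSL) (h : hom J K) :
  cpm (c := opposite CJSL) (dual_counit K)
    (fmap (Top_sierpinski ∘F CJSL_two) h) =
  cpm (c := opposite CJSL) h (dual_counit J).
Proof. by apply: cjsl_homP => j; exact/continuousEP. Qed.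

Fact dual_triangleL (X : Top) :
  cpm (c := opposite CJSL) (dual_counit (Top_sierpinski X))
    (fmap Top_sierpinski
       (dual_unit X : hom (c := Top) X (cjsl_points (opens_cjsl X)))) =
  idm (Top_sierpinski X).
Proof. by apply: cjsl_homP => U; exact/continuousEP. Qed.

Fact dual_triangleR (J : opposite CJSL) :
  cpm (c := Top)
    (fmap CJSL_two
       (dual_counit J :
          hom (c := opposite CJSL) (opens_cjsl (cjsl_points J)) J))
    (dual_unit (CJSL_two J)) =
  idm (CJSL_two J).
Proof. by apply/continuousEP => phi; exact: cjsl_homP. Qed.

Definition dual_adjunction : adjunction Top_sierpinski CJSL_two :=
  @Adjunction Top (opposite CJSL) Top_sierpinski CJSL_two
    (@NatTrans Top Top (functor_id Top) (CJSL_two ∘F Top_sierpinski)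
       dual_unit dual_unit_nat)
    (@NatTrans (opposite CJSL) (opposite CJSL) (Top_sierpinski ∘F CJSL_two)
       (functor_id (opposite CJSL)) dual_counit dual_counit_nat)
    dual_triangleL dual_triangleR.

Definition lower_vietoris_monad : monad Top := adjunction_monad dual_adjunction.

Definition closed_sets (X : topologicalType) : Type := {C : set X | closed C}.
HB.instance Definition _ (X : topologicalType) := gen_eqMixin (closed_sets X).
HB.instance Definition _ (X : topologicalType) := gen_choiceMixin (closed_sets X).

Definition hits (X : topologicalType) (U : set X) : set (closed_sets X) :=
  [set C | sval C `&` U !=set0].

HB.instance Definition _ (X : topologicalType) :=
  isSubBaseTopological.Build (closed_sets X) open (@hits X).

Section Kleisli.
Implicit Types X Y Z W : Type.

Definition power_ext X Y (f : X -> set Y) (A : set X) : set Y := \bigcup_(x in A) f x.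

Definition rel_id X (x : X) : set X := [set x].

Definition rel_comp X Y Z (g : Y -> set Z) (f : X -> set Y) : X -> set Z :=
  fun x => power_ext g (f x).

Fact rel_compA X Y Z W (h : Z -> set W) (g : Y -> set Z) (f : X -> set Y) :
  rel_comp h (rel_comp g f) = rel_comp (rel_comp h g) f.
Proof.
apply/funext => x; rewrite /rel_comp /power_ext; apply/seteqP; split=> w.
- by move=> [z [y fy gz] hw]; exists y => //; exists z.
- by move=> [y fy [z gz hw]]; exists z => //; exists y.
Qed.

Fact rel_comp1 X Y (f : X -> set Y) : rel_comp f (@rel_id X) = f.
Proof. by apply/funext => x; rewrite /rel_comp /power_ext bigcup_set1. Qed.

Fact rel_1comp X Y (f : X -> set Y) : rel_comp (@rel_id Y) f = f.
Proof.
apply/funext => x; apply/seteqP; split=> [y [z fz ->]//|y fy]; by exists y.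
Qed.
End Kleisli.

(* The Kleisli category of the power set monad.                                *)
Definition KlP : category :=
  @Category Type (fun X Y => X -> set Y) rel_id rel_comp rel_compA rel_comp1 rel_1comp.

(* Forces the universe of [KlP] to contain the underlying sets of all spaces:  *)
(* the sets of [KlP] must not be small relative to [Top].                      *)
Definition underlying_set (X : topologicalType) : KlP := (X : Type).

Definition char_set (X : Type) (A : set X) : {ptws X -> sierpinski} :=
  fun x => `[< A x >].

Definition set_of_char (X : Type) (phi : {ptws X -> sierpinski}) : set X :=
  [set x | phi x = true].

Section UP.
Variables (X Y : Type) (f : X -> set Y).

Definition UP_map_fun (phi : {ptws X -> sierpinski}) : {ptws Y -> sierpinski} :=
  char_set (power_ext f (set_of_char phi)).

Fact UP_map_continuous : continuous UP_map_fun.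
Proof.
apply: continuous_power => y; apply/continuous_sierpinski.
rewrite (_ : [set _ | _] =
    \bigcup_(x in [set x | f x y]) [set phi | phi x = true]).
  apply: bigcup_open => x _.
  exact: (continuous_sierpinski _).1 (@continuous_eval X sierpinski x).
apply/seteqP; split=> phi /=.
- by move=> /asboolP[x phix fxy]; exists x.
- by move=> [x fxy phix]; apply/asboolP; exists x.
Qed.

Definition UP_map :
    continuousType {ptws X -> sierpinski} {ptws Y -> sierpinski} :=
  mkcts UP_map_continuous.
End UP.

Fact UP_map1 (X : KlP) : UP_map (idm X) = idm (c := Top) {ptws X -> sierpinski}.
Proof.
apply/continuousEP => phi; apply/funext => x; apply/asboolP/idP => /=.
- by move=> [y phiy ->].
- by move=> phix; exists x.
Qed.

Fact UP_mapM (X Y Z : KlP) (g : hom Y Z) (f : hom X Y) :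
  UP_map (g ∘ f) = cpm (c := Top) (UP_map g) (UP_map f).
Proof.
apply/continuousEP => phi; apply/funext => z; apply/asboolP/asboolP => /=.
- by move=> [x phix [y fxy gyz]]; exists y => //; apply/asboolP; exists x.
- by move=> [y /asboolP[x phix fxy] gyz]; exists x => //; exists y.
Qed.

Definition UP : functor KlP Top :=
  @Functor KlP Top (fun X => {ptws X -> sierpinski}) UP_map UP_map1 UP_mapM.

(* Main.v *)
(** An open set of [X] is a map [X -> S = S^1], and a join-preserving map on the
    opens of [S^I] restricts to a point of [S^I] by evaluation at the coordinate
    opens; this is the counit [V (S^I) -> S^I]. Given [alpha : G UP => UP], the
    requirement on a lift [beta : G => V] together with its naturality along
    [U : X -> S^1] forces [beta t U = alpha_1 (G U t)]. Conversely this formula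
    preserves joins: a family [U_i] of opens is one map [X -> S^I], and both its
    union and its members are obtained from it by composing with the images under
    [UP] of relations from [I] to [1], along which [alpha] is natural.

    A join-preserving [phi] on the opens of [X] corresponds to the complement of
    the largest open set killed by [phi]. *)

Require Import Defs.
From mathcomp Require Import all_boot all_order all_classical.
From mathcomp Require Import topology.

Set Implicit Arguments.
Unset Strict Implicit.
Unset Printing Implicit Defensive.

Local Open Scope classical_set_scope.

(** * Equality of natural transformations and the identity isomorphism of a monad *)

Lemma nat_transP (C D : category) (F G : functor C D) (s t : F ⟹ G) :
  (forall X, s X = t X) -> s = t.
Proof.
case: s t => [s sP] [t tP] /= st.
have {}st : s = t by exact: functional_extensionality_dep.
by subst t; rewrite (Prop_irrelevance sP tP).
Qed.

Definition nat_id (C D : category) (F : functor C D) : F ⟹ F.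
Proof.
apply: (@NatTrans _ _ F F (fun X => idm (F X))) => X Y f.
by rewrite cp1m cpm1.
Defined.

Lemma monad_isomorphic_refl (C : category) (T : monad C) : monad_isomorphic T T.
Proof.
have idP : is_monad_morphism (nat_id T).
  by split=> X /=; rewrite ?cp1m ?cpm1 ?fmap1 ?cpm1.
by exists (nat_id T), (nat_id T); split=> // X /=; rewrite cp1m.
Qed.

(** * Points of the semilattice of opens as closed subsets *)

Definition opens_of (X : topologicalType) (U : set X) (oU : open U) : opens X.
Proof.
apply: (@mkcts X sierpinski (fun x => `[< U x >] : sierpinski)).
apply/continuous_sierpinski; rewrite (_ : [set _ | _] = U) //.
by apply/seteqP; split=> x /asboolP.
Defined.

Section ClosedSets.
Variable X : topologicalType.
Implicit Types (phi : cjsl_points (opens_cjsl X)) (U : opens X).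

Definition opens_set U : set X := [set x | U x = true].

Lemma open_opens_set U : open (opens_set U).
Proof. exact/continuous_sierpinski/cts_fun. Qed.

Lemma cjsl_points_joinP phi (A : set (opens X)) :
  phi (opens_join A) = true <-> exists2 U, A U & phi U = true.
Proof.
rewrite (cjsl_funP phi A) /=; split=> [/asboolP[U AU pU]|[U AU pU]].
  by exists U.
by apply/asboolP; exists U.
Qed.

Lemma open_hits (U : set X) : open U -> open (hits U).
Proof.
move=> oU; exists [set hits U]; last by rewrite bigcup_set1.
by move=> _ ->; apply: finI_from1.
Qed.

(** The sets [hits U] form only a subbase, but preimages commute with unions and finite
    intersections. *)
Lemma continuous_hits (Y : topologicalType) (f : Y -> closed_sets X) :
  (forall U : set X, open U -> open (f @^-1` hits U)) -> continuous f.
Proof.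
move=> fP; apply/continuousP => _ [D DI <-].
rewrite preimage_bigcup; apply: bigcup_open => B /DI [E EU <-].
rewrite preimage_bigcap bigcap_fset big_seq; elim/big_ind: _ => [||U UE].
- exact: openT.
- exact: openI.
- by apply: fP; move/EU: UE; rewrite inE.
Qed.

Definition closed_of_points_fun phi : closed_sets X :=
  exist (@closed X) (~` opens_set (opens_join [set U | phi U = false]))
    (open_closedC (open_opens_set _)).

(** If [phi] kills [U], then [U] lies in the union of all killed opens and misses its complement. If
    [U] misses that complement, the union absorbs [U], and since [phi] kills the union it kills
    [U]. *)
Lemma closed_of_points_hits phi U :
  hits (opens_set U) (closed_of_points_fun phi) <-> phi U = true.
Proof.
split=> [[x [/= xC xU]]|pU].
  apply/negPn/negP => /negbTE pU; apply: xC.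
  by apply/asboolP; exists U.
apply: contrapT => CU; set W := opens_join [set V | phi V = false].
(* This is contradictory: truth on the join [W] of killed opens would come from truth on some killed
   [V]. *)
have /cjsl_points_joinP[V /= -> //] : phi W = true.
have <- : opens_join [set U; W] = W.
  apply/continuousEP => x; apply/asboolP/idP => /= [[V [] -> // Ux]|Wx].
    by apply: contrapT => Wx; apply: CU; exists x.
  by exists W => //; right.
by apply/cjsl_points_joinP; exists U => //; left.
Qed.

Lemma closed_of_points_continuous : continuous closed_of_points_fun.
Proof.
apply: continuous_hits => U oU.
have -> : closed_of_points_fun @^-1` hits U = [set phi | phi (opens_of oU) = true].
  rewrite -[U in hits U](_ : opens_set (opens_of oU) = U).
    by apply/seteqP; split=> phi /closed_of_points_hits.
  by apply/seteqP; split=> x /asboolP.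
exact/continuous_sierpinski/(@continuous_cjsl_eval (opens_cjsl X)).
Qed.

Lemma points_of_closed_join (C : closed_sets X) (A : set (opens X)) :
  `[< hits (opens_set (opens_join A)) C >] =
  bool_join [set `[< hits (opens_set U) C >] | U in A].
Proof.
apply/asboolP/asboolP => [[x [Cx /asboolP[U AU Ux]]]|[U AU /asboolP[x [Cx Ux]]]].
  by exists U => //; apply/asboolP; exists x.
by exists x; split=> //; apply/asboolP; exists U.
Qed.

Definition points_of_closed_fun (C : closed_sets X) : cjsl_points (opens_cjsl X) :=
  @CjslHom (opens_cjsl X) two (fun U => `[< hits (opens_set U) C >])
    (points_of_closed_join C).

Lemma points_of_closed_continuous : continuous points_of_closed_fun.
Proof.
apply: continuous_cjsl_points => U; apply/continuous_sierpinski.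
rewrite (_ : [set _ | _] = hits (opens_set U)).
  exact/open_hits/open_opens_set.
by apply/seteqP; split=> C /asboolP.
Qed.

Lemma closed_of_pointsK : cancel closed_of_points_fun points_of_closed_fun.
Proof.
move=> phi; apply: cjsl_homP => U /=.
by apply/asboolP/idP => /closed_of_points_hits.
Qed.

Lemma points_of_closedK : cancel points_of_closed_fun closed_of_points_fun.
Proof.
move=> [C cC]; apply: eq_exist; apply/seteqP; split=> x /=.
  apply: contra_notP => Cx; apply/asboolP.
  (* Closedness enters here: the complement of [C] is an open that [C] misses, so it is among the
     killed opens. *)
  exists (opens_of (closed_openC cC)); last by apply/asboolP.
  by apply/asboolP => -[y [Cy /asboolP]].
move=> Cx /asboolP[U /= /asboolP + Ux]; apply.
by exists x.
Qed.

Lemma lower_vietoris_closed_sets :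
  @isomorphic Top (lower_vietoris_monad X) (closed_sets X).
Proof.
exists (mkcts closed_of_points_continuous : continuousType _ _).
exists (mkcts points_of_closed_continuous : continuousType _ _).
split; apply/continuousEP.
  exact: closed_of_pointsK.
exact: points_of_closedK.
Qed.

End ClosedSets.

(** * The counit, given by evaluation at coordinate opens *)

Definition coord (I : Type) (i : I) : opens {ptws I -> sierpinski} :=
  mkcts (@continuous_eval I sierpinski i).

Definition codensity_counit_fun (I : Type)
    (phi : cjsl_points (opens_cjsl {ptws I -> sierpinski})) :
  {ptws I -> sierpinski} := fun i => phi (coord i).

Lemma codensity_counit_continuous (I : Type) :
  continuous (@codensity_counit_fun I).
Proof. by apply: continuous_power => i; exact: continuous_cjsl_eval. Qed.

Definition codensity_counit_cts (I : Type) :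
    continuousType (cjsl_points (opens_cjsl {ptws I -> sierpinski}))
      {ptws I -> sierpinski} :=
  mkcts (@codensity_counit_continuous I).

(** This turns naturality of the counit into preservation of joins: coordinate opens pull back along
    [UP_map f] to unions of coordinate opens. *)
Lemma opens_map_UP (I J : Type) (f : I -> set J) (j : J) :
  opens_map (UP_map f) (coord j) = opens_join [set coord i | i in [set i | f i j]].
Proof.
apply/continuousEP => g; apply/asboolP/asboolP => /=.
  by move=> [i gi fij]; exists (coord i) => //; exists i.
by move=> [_ [i fij <-] gi]; exists i.
Qed.

Lemma codensity_counit_nat (I J : KlP) (f : hom I J) :
  cpm (c := Top) (codensity_counit_cts J)
    (Defs.fmap (lower_vietoris_monad ∘F UP) f) =
  cpm (c := Top) (Defs.fmap UP f) (codensity_counit_cts I).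
Proof.
apply/continuousEP => phi; apply/funext => j.
change (phi (opens_map (UP_map f) (coord j)) =
  UP_map f (codensity_counit_fun phi) j); rewrite opens_map_UP.
apply/idP/asboolP => [/cjsl_points_joinP[_ [i fij <-] pi]|[i pi fij]].
  by exists i.
by apply/cjsl_points_joinP; exists (coord i) => //; exists i.
Qed.

Definition codensity_counit : lower_vietoris_monad ∘F UP ⟹ UP :=
  @NatTrans KlP Top (lower_vietoris_monad ∘F UP) UP
    codensity_counit_cts codensity_counit_nat.

Lemma codensity_counit_unit (I : KlP) :
  cpm (c := Top) (codensity_counit I) (munit lower_vietoris_monad (UP I)) =
  idm (UP I).
Proof. exact/continuousEP. Qed.

(** At coordinate [i] both sides evaluate [Phi] at the same open, that of the points [phi] with
    [phi (coord i) = true]. *)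
Lemma codensity_counit_mult (I : KlP) :
  cpm (c := Top) (codensity_counit I) (mmult lower_vietoris_monad (UP I)) =
  cpm (c := Top) (codensity_counit I)
    (Defs.fmap lower_vietoris_monad (codensity_counit I)).
Proof.
apply/continuousEP => Phi; apply/funext => i.
rewrite /= /codensity_counit_fun /=.
by congr (cjsl_fun Phi _); apply/continuousEP.
Qed.

(** * The universal property: lifting [alpha] through the counit *)

Section Extension.
Variables (G : functor Top Top) (alpha : G ∘F UP ⟹ UP).

Definition opens_tuple_fun (X : topologicalType) (I : Type) (U : I -> opens X) (x : X) :
  {ptws I -> sierpinski} := fun i => U i x.

Lemma opens_tuple_continuous (X : topologicalType) (I : Type) (U : I -> opens X) :
  continuous (opens_tuple_fun U).
Proof. by apply: continuous_power => i; exact: (@cts_fun _ _ (U i)). Qed.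

Definition opens_tuple (X : topologicalType) (I : Type) (U : I -> opens X) :
  continuousType X {ptws I -> sierpinski} := mkcts (@opens_tuple_continuous X I U).

(** [Gmap] and [alpha_cts] retype the categorical data as continuous maps, so that they apply to
    points. *)
Definition Gmap (X Y : topologicalType) (f : continuousType X Y) :
  continuousType (G X : topologicalType) (G Y : topologicalType) :=
  Defs.fmap G (f : @hom Top X Y).

Definition alpha_cts (I : Type) : continuousType
    (G {ptws I -> sierpinski} : topologicalType) {ptws I -> sierpinski} :=
  alpha I.

Lemma GmapM (X Y Z : topologicalType) (g : continuousType Y Z)
  (f : continuousType X Y) t : Gmap (top_comp g f) t = Gmap g (Gmap f t).
Proof.
by rewrite /Gmap (@fmapM _ _ G X Y Z g f).
Qed.

Lemma alpha_nat (I J : Type) (f : I -> set J) t :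
  alpha_cts J (Gmap (UP_map f) t) = UP_map f (alpha_cts I t).
Proof.
have := @ntr_nat _ _ _ _ alpha I J f.
by move=> /(congr1 (fun h : continuousType _ _ => h t)).
Qed.

Definition lift_val (X : topologicalType) (t : (G X : topologicalType))
  (U : opens X) : two := alpha_cts unit (Gmap (opens_tuple (fun=> U)) t) tt.

Lemma lift_val_tuple (X : topologicalType) (I : Type) (U : I -> opens X)
    (t : (G X : topologicalType)) (A : set I) :
  lift_val t (opens_join (U @` A)) =
  `[< exists2 i, A i & alpha_cts I (Gmap (opens_tuple U) t) i = true >].
Proof.
(* The relation with domain [A] to the one-point set: [UP_map r] sends a tuple to the join of its
   coordinates in [A]. *)
pose r (i : I) : set unit := [set _ | A i].
rewrite /lift_val.
have -> : opens_tuple (fun=> opens_join (U @` A)) = top_comp (UP_map r) (opens_tuple U).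
  apply/continuousEP => x; apply/funext => -[].
  apply/asboolP/asboolP => [[_ [i Ai <-] Ux]|[i Ux Ai]]; first by exists i.
  by exists (U i) => //; exists i.
rewrite GmapM alpha_nat.
by apply/asboolP/asboolP => -[i ? ?]; exists i.
Qed.

(** This is the singleton case of [lift_val_tuple]. *)
Lemma lift_val_coord (X : topologicalType) (I : Type) (U : I -> opens X)
    (t : (G X : topologicalType)) (i : I) :
  alpha_cts I (Gmap (opens_tuple U) t) i = lift_val t (U i).
Proof.
have -> : U i = opens_join (U @` [set i]).
  rewrite image_set1; apply/continuousEP => x.
  by apply/idP/asboolP => [Ux|[_ -> //]]; exists (U i).
rewrite lift_val_tuple.
by apply/idP/asboolP => [ti|[_ -> //]]; exists i.
Qed.

Lemma lift_val_join (X : topologicalType) (t : (G X : topologicalType))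
    (A : set (opens X)) :
  lift_val t (opens_join A) = bool_join [set lift_val t U | U in A].
Proof.
(* The opens of [X] index themselves: [I] is [opens X], the tuple is the identity family, and [A]
   becomes a set of indices. *)
rewrite -[A in LHS]image_id lift_val_tuple.
apply/asboolP/asboolP => -[U AU tU]; exists U => //.
  by rewrite -(lift_val_coord id).
by rewrite lift_val_coord.
Qed.

Definition lift_fun (X : topologicalType) (t : (G X : topologicalType)) :
  cjsl_points (opens_cjsl X) :=
  @CjslHom (opens_cjsl X) two (lift_val t) (lift_val_join t).

Lemma lift_continuous (X : topologicalType) : continuous (@lift_fun X).
Proof.
apply: continuous_cjsl_points => U t.
apply: (@continuous_comp _ _ _
  (fun t => alpha_cts unit (Gmap (opens_tuple (fun=> U)) t)) (fun g => g tt)).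
  exact: (@cts_fun _ _ (top_comp (alpha_cts unit) (Gmap _))).
exact: continuous_eval.
Qed.

Definition lift_cts (X : topologicalType) :
    continuousType (G X : topologicalType) (cjsl_points (opens_cjsl X)) :=
  mkcts (@lift_continuous X).

Lemma lift_nat (X Y : Top) (f : hom X Y) :
  cpm (c := Top) (lift_cts Y) (Defs.fmap G f) =
  cpm (c := Top) (Defs.fmap lower_vietoris_monad f) (lift_cts X).
Proof.
apply/continuousEP => t; apply: cjsl_homP => U.
rewrite /= /lift_val -/(Gmap f) -GmapM.
by congr (alpha_cts _ (Gmap _ _) _); apply/continuousEP.
Qed.

Definition lift : G ⟹ lower_vietoris_monad :=
  @NatTrans Top Top G lower_vietoris_monad lift_cts lift_nat.

Lemma lift_counit (I : KlP) :
  cpm (c := Top) (codensity_counit I) (lift (UP I)) = alpha I.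
Proof.
apply/continuousEP => t; apply/funext => i.
change (lift_val t (coord i) = alpha_cts I t i).
rewrite -(lift_val_coord (@coord I)).
(* Tupling all coordinate opens of a power gives its identity map, which [G] preserves. *)
have -> : opens_tuple (@coord I) = idfun by exact/continuousEP.
by rewrite /Gmap (@fmap1 _ _ G {ptws I -> sierpinski}).
Qed.

Lemma lift_unique (beta : G ⟹ lower_vietoris_monad) :
  (forall I : KlP, cpm (c := Top) (codensity_counit I) (beta (UP I)) = alpha I) ->
  lift = beta.
Proof.
move=> betaP; apply: nat_transP => X; apply/continuousEP => t.
apply: cjsl_homP => U; rewrite /= /lift_val /alpha_cts -betaP.
(* Naturality of [beta] along [U], seen as a map into the power with one coordinate, is read at [t]
   and that coordinate. *)
have /(congr1 (fun h : continuousType (G X : topologicalType)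
  (cjsl_points (opens_cjsl {ptws unit -> sierpinski})) => h t (coord tt))) :=
  ntr_nat beta (opens_tuple (fun=> U) : @hom Top X {ptws unit -> sierpinski}).
move=> E; apply: (etrans E).
pose phi : cjsl_points (opens_cjsl X) := beta X t.
(* Pulling back the only coordinate open along this map returns [U]. *)
change (phi (opens_map (opens_tuple (fun=> U)) (coord tt)) = phi U).
by congr (cjsl_fun phi _); exact/continuousEP.
Qed.

End Extension.

Lemma codensity_counit_right_kan : is_right_kan codensity_counit.
Proof.
move=> G alpha; exists (lift alpha); split; first exact: lift_counit.
exact: lift_unique.
Qed.

Theorem theorem5p2 :
  (forall X : topologicalType,
     @isomorphic Top (lower_vietoris_monad X) (closed_sets X)) /\
  exists T : monad Top,
    is_codensity_monad UP T /\ monad_isomorphic lower_vietoris_monad T.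
Proof.
split; first exact: lower_vietoris_closed_sets.
exists lower_vietoris_monad; split; last exact: monad_isomorphic_refl.
exists codensity_counit; split.
- exact: codensity_counit_right_kan.
- exact: codensity_counit_unit.
- exact: codensity_counit_mult.
Qed.
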